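(* Let $V$ be a finite set and $E\subset\{(x,y)\in V\times V:x\ne y\}$ a set of directed edges. Let $R$ and $R'$ be jump rates of two continuous-time Markov chains on $V$ such that, for $x\neq y$, $R(x,y)>0\iff(x,y)\in E\iff R'(x,y)>0$. Assume that all elements of $V$ are recurrent (for these chains). If the measure-current rate functionals $I$ and $I'$ associated with $R$ and $R'$ coincide on $\mathscr P(V)\times\mathfrak F_E$, then $R(x,y)=R'(x,y)$ for all $(x,y)\in E$. In other words, the jump rates can be recovered from the measure-current rate functional $I:\mathscr P(V)\times\mathfrak F_E\to[0,+\infty]$.
   Context: The chains need not be irreducible; recurrence of all elements depends only on $E$ (every point belongs to a closed irreducible class). $\mathscr P(V)$ is the set of probability measures on $V$. A flow is a function $J:E\to\mathbb R_+=[0,\infty)$; $\mathfrak F_E$ is the set of flows, and $\mathfrak F_E^{\rm div}$ the set of flows with $\sum_{y:(x,y)\in E}J(x,y)=\sum_{y:(y,x)\in E}J(y,x)$ for all $x\in V$. $\Phi(q,p)=p$ if $q=0$; $\Phi(q,p)=q\log(q/p)-(q-p)$ if $q,p\in(0,\infty)$; $\Phi(q,p)=+\infty$ if $q>0$, $p=0$. The measure-current (Bertini–Faggionato–Gabrielli) rate functional associated with $R$ is $I(\mu,J)=\sum_{(x,y)\in E}\Phi(J(x,y),\mu(x)R(x,y))$ if $J\in\mathfrak F_E^{\rm div}$, and $I(\mu,J)=+\infty$ otherwise. *)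

(* Defs.v *)
From mathcomp Require Import all_boot all_order all_algebra.
From mathcomp Require Import interval_inference reals constructive_ereal ereal.
From mathcomp Require Import exp.

Set Implicit Arguments.
Unset Strict Implicit.
Unset Printing Implicit Defensive.

Import Order.TTheory GRing.Theory Num.Theory.

Local Open Scope ring_scope.

(* Only the off-diagonal entries of [r] carry information; the diagonal is
   unconstrained and never used. *)
Definition jump_rates (R : realType) (V : finType) (r : V -> V -> R) : Prop :=
  forall x y : V, x != y -> 0 <= r x y.

Definition jump_rel (R : realType) (V : finType) (r : V -> V -> R) : rel V :=
  fun x y => (x != y) && (0 < r x y).

Definition closed_class (R : realType) (V : finType) (r : V -> V -> R)
    (C : {set V}) : Prop :=
  forall x y : V, x \in C -> jump_rel r x y -> y \in C.

Definition irreducible_class (R : realType) (V : finType) (r : V -> V -> R)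
    (C : {set V}) : Prop :=
  forall x y : V, x \in C -> y \in C -> connect (jump_rel r) x y.

(* A state of a finite chain is recurrent when it lies in a closed irreducible
   class; since [connect] is reflexive, absorbing states are recurrent. *)
Definition recurrent (R : realType) (V : finType) (r : V -> V -> R) (x : V)
    : Prop :=
  exists C : {set V}, [/\ x \in C, closed_class r C & irreducible_class r C].

(* A probability measure on a finite set, given by its masses of points. *)
Record fin_prob (R : realType) (V : finType) := FinProb {
  mass :> V -> R;
  mass_ge0 : forall x : V, 0 <= mass x;
  mass_sum1 : \sum_(x : V) mass x = 1 }.

Definition edge (V : finType) (E : {set V * V}) := {e : V * V | e \in E}.

Definition esrc (V : finType) (E : {set V * V}) (e : edge E) : V := (sval e).1.
Definition etgt (V : finType) (E : {set V * V}) (e : edge E) : V := (sval e).2.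

Definition flow (R : realType) (V : finType) (E : {set V * V}) :=
  edge E -> {nonneg R}.

Definition div_free (R : realType) (V : finType) (E : {set V * V})
    (J : flow R E) : bool :=
  [forall x : V, \sum_(e : edge E | esrc e == x) (J e)%:num
              == \sum_(e : edge E | etgt e == x) (J e)%:num].

(* Meaningful for [q, p >= 0] only, the only arguments it is applied to. *)
Definition Phi (R : realType) (q p : R) : \bar R :=
  if q == 0 then p%:E
  else if p == 0 then +oo%E
  else (q * ln (q / p) - (q - p))%:E.

Definition rate_functional (R : realType) (V : finType) (E : {set V * V})
    (r : V -> V -> R) (mu : fin_prob R V) (J : flow R E) : \bar R :=
  if div_free J
  then (\sum_(e : edge E) Phi (J e)%:num (mu (esrc e) * r (esrc e) (etgt e)))%E
  else +oo%E.

(* Main.v *)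
(** Since [Phi q p >= 0], with equality for [q > 0] only when [p = q], the
    functional [I] vanishes at [(mu, mu R)] for [mu] invariant under [R]; then
    so does [I'], which forces [mu R = mu R'] edge by edge.  It remains to find,
    for each recurrent [x], an invariant [mu] charging [x].  If every solution
    [v] of the balance equations vanished at [x], the Fredholm alternative would
    give [h] with [L h] the indicator of [x], against the maximum principle on
    the class of [x]; so some solution has [v x <> 0], and [`|v|] is again a
    solution. *)

Require Import Defs.
From mathcomp Require Import all_boot all_order all_algebra.
From mathcomp Require Import reals.
From mathcomp Require Import interval_inference constructive_ereal sequences exp.
From mathcomp Require Import ring.

Import Order.TTheory GRing.Theory Num.Theory.

Local Open Scope ring_scope.

Section WeightedDigraph.
Context {R : realFieldType} {V T : finType} (src tgt : T -> V) (w : T -> R).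

Let adj : rel V := [rel a b | [exists e, (src e == a) && (tgt e == b)]].

Definition laplacian (h : V -> R) (a : V) : R :=
  \sum_(e | src e == a) w e * (h (tgt e) - h a).

(** The balance equations of the chain that jumps along [e] at rate [w e]; their solutions form the
    kernel of the transpose of [laplacian]. *)
Definition kirchhoff (v : V -> R) : Prop :=
  forall a, \sum_(e | src e == a) v (src e) * w e
          = \sum_(e | tgt e == a) v (src e) * w e.

Lemma sum_fibers (f : T -> V) (F : T -> R) :
  \sum_a \sum_(e | f e == a) F e = \sum_e F e.
Proof. by rewrite [RHS](partition_big f xpredT). Qed.

(** [B] is [laplacian] acting on row vectors. Either the indicator of [x] lies in its row space, or
    some column of [cokermx B] is nonzero at [x]; [B] kills that column, which is the balance
    equation. *)
Lemma fredholm_digraph (x : V) :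
  (exists2 v, kirchhoff v & v x != 0) \/
  (exists h, forall a, laplacian h a = (a == x)%:R).
Proof.
pose B : 'M[R]_#|V| := \matrix_(k, i) \sum_(e | src e == enum_val i)
  w e * ((enum_rank (tgt e) == k)%:R - (i == k)%:R).
pose d : 'rV[R]_#|V| := delta_mx 0 (enum_rank x).
have [/submxP[h hB]|] := boolP (d <= B)%MS.
  right; exists (fun a => h 0 (enum_rank a)) => a.
  have /matrixP/(_ 0 (enum_rank a)) := hB.
  rewrite !mxE eqxx /= (inj_eq enum_rank_inj) => ->.
  under [RHS]eq_bigr do rewrite mxE mulr_sumr.
  rewrite exchange_big /= enum_rankK; apply: eq_bigr => e _.
  rewrite mulrBr [w e * h 0 (enum_rank (tgt e))]mulrC [w e * _]mulrC.
  under eq_bigr do rewrite mulrCA mulrBr mulrBr.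
  rewrite sumrB (bigD1 (enum_rank (tgt e))) //= eqxx mulr1.
  rewrite big1 ?addr0; last by move=> k /negPf kN; rewrite eq_sym kN !mulr0.
  rewrite (bigD1 (enum_rank a)) //= eqxx mulr1.
  rewrite big1 ?addr0; last by move=> k /negPf kN; rewrite eq_sym kN !mulr0.
  by ring.
rewrite submxE => /matrix0Pn[i0 [j]]; rewrite {}(ord1 i0) => dn0.
left; exists (fun a => cokermx B (enum_rank a) j); last first.
  by move: dn0; rewrite /d -rowE mxE.
move=> a; have /matrixP/(_ (enum_rank a) j) := mulmx_coker B.
rewrite !mxE; under eq_bigr do rewrite mxE mulr_suml.
rewrite (reindex (@enum_rank V)) /=; last first.
  by exists enum_val => ? _; rewrite ?enum_rankK ?enum_valK.
(* Writing [b] as [src e] on its fiber lets [sum_fibers] collapse the double sum into one over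
   edges. *)
rewrite (eq_bigr (fun b => \sum_(e | src e == b) w e *
    ((tgt e == a)%:R - (src e == a)%:R) * cokermx B (enum_rank (src e)) j)).
  2: { move=> b _; rewrite enum_rankK; apply: eq_bigr => e /eqP ->.
    by rewrite !(inj_eq enum_rank_inj). }
rewrite sum_fibers.
move=> sum0; apply/eqP; rewrite eq_sym -subr_eq0; apply/eqP.
rewrite big_mkcond [X in _ - X]big_mkcond -sumrB -[RHS]sum0.
by apply: eq_bigr => e _; do 2 case: eqP => _ /=; ring.
Qed.

Hypothesis w_gt0 : forall e, 0 < w e.

(** Let [m] maximize [h] over the vertices reachable from [x]. Harmonicity carries the maximal value
    along a path from [m] back to [x], and at a maximum every term of the Laplacian is
    nonpositive. *)
Lemma maximum_principle (x : V) (h : V -> R) :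
    (forall y, connect adj x y -> connect adj y x) ->
  (forall a, a != x -> laplacian h a = 0) -> laplacian h x <= 0.
Proof.
move=> rec harm.
have [m /= xm mmax] := @arg_maxP _ _ _ x (connect adj x) h (connect0 _ x).
have terms_le0 a : connect adj x a -> h a = h m ->
    forall e, src e == a -> w e * (h (tgt e) - h a) <= 0.
  move=> xa ha e /eqP ea; rewrite pmulr_rle0 // subr_le0 ha; apply: mmax.
  apply: (connect_trans xa); apply: connect1.
  by apply/existsP; exists e; rewrite ea !eqxx.
suff hx : h x = h m by apply: sumr_le0 => e; apply: terms_le0.
have /connectP[p] := rec m xm.
suff: forall a, connect adj x a -> h a = h m ->
    path adj a p -> x = last a p -> h x = h m by move/(_ m xm (erefl _)).
elim: p => [|b p IHp] a xa ha /=; first by move=> _ ->.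
have [<- // | ax] := eqVneq a x.
move=> /andP[ab pp] xlast; apply: (IHp b) => //.
  exact: connect_trans xa (connect1 ab).
have /existsP[e /andP[ea /eqP <-]] := ab.
(* A vanishing sum of nonpositive terms has only zero terms, so the next vertex of the path also
   attains the maximum. *)
have /eqP := harm a ax.
rewrite -oppr_eq0 -sumrN psumr_eq0; last first.
  by move=> e' /(terms_le0 a xa ha); rewrite oppr_ge0.
move=> /allP/(_ e (mem_index_enum e)); rewrite ea /= oppr_eq0 mulf_eq0.
by rewrite gt_eqF //= subr_eq0 => /eqP ->.
Qed.

(* The triangle inequality gives one inequality at each vertex; both sides
   have the same total over all vertices, so each of them is an equality. *)
Lemma kirchhoff_norm (v : V -> R) : kirchhoff v -> kirchhoff (fun a => `|v a|).
Proof.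
move=> vK.
have le_in a : \sum_(e | src e == a) `|v (src e)| * w e
            <= \sum_(e | tgt e == a) `|v (src e)| * w e.
  (* All edges out of [a] share the factor [v a], so the outflow has no cancellation. *)
  have -> : \sum_(e | src e == a) `|v (src e)| * w e
          = `|\sum_(e | src e == a) v (src e) * w e|.
    under eq_bigr => e /eqP -> do [].
    under [in RHS]eq_bigr => e /eqP -> do [].
    rewrite -!mulr_sumr normrM [`|\sum_(e | _) _|]ger0_norm //.
    by apply: sumr_ge0 => e _; apply: ltW.
  rewrite vK; apply: le_trans (ler_norm_sum _ _ _) _.
  by apply: ler_sum => e _; rewrite normrM (gtr0_norm (w_gt0 e)).
move=> a; apply/eqP; rewrite eq_sym -subr_eq0.
have: \sum_a (\sum_(e | tgt e == a) `|v (src e)| * w e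
            - \sum_(e | src e == a) `|v (src e)| * w e) == 0.
  by rewrite sumrB !sum_fibers subrr.
rewrite psumr_eq0; last by move=> b _; rewrite subr_ge0.
by move=> /allP/(_ a (mem_index_enum a)).
Qed.

Lemma invariant_measure (x : V) :
    (forall y, connect adj x y -> connect adj y x) ->
  exists v : V -> R, [/\ forall a, 0 <= v a, 0 < v x & kirchhoff v].
Proof.
move=> rec; have [[v vK vx]|[h hL]] := fredholm_digraph x.
  exists (fun a => `|v a|); split=> //; first by rewrite normr_gt0.
  exact: kirchhoff_norm.
have := @maximum_principle x h rec; rewrite hL eqxx ler10; case/(_ _)/notF.
by move=> a /negPf ax; rewrite hL ax.
Qed.

End WeightedDigraph.

(** A closed class contains all that is reachable from its points; irreducibility then supplies the
    way back. *)
Lemma recurrent_connect (R : realType) (V : finType) (r : V -> V -> R) (x y : V) :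
  recurrent r x -> connect (jump_rel r) x y -> connect (jump_rel r) y x.
Proof.
move=> [C [xC Cclosed Cirr]] /connectP[p pth ->]; apply: Cirr => //.
elim: p x xC pth => //= z p IHp x xC /andP[xz pth].
exact: IHp (Cclosed _ _ xC xz) pth.
Qed.

Section Phi.
Variable R : realType.
Implicit Types p q : R.

Lemma Phi_diag q : Phi q q = 0%:E.
Proof.
rewrite /Phi; case: eqP => [->//|/eqP q0].
by rewrite divff // ln1 mulr0 subrr subr0.
Qed.

(** This substitution reduces the sign of [Phi] and its equality case to [1 + t <= expR t], strict
    for [t != 0]. *)
Lemma Phi_expR q (t : R) : 0 < q ->
  Phi q (q * expR t) = (q * (expR t - (1 + t)))%:E.
Proof.
move=> q0; rewrite /Phi !gt_eqF ?mulr_gt0 ?expR_gt0 //; congr (_%:E).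
rewrite invfM mulrA divff ?gt_eqF // mul1r -expRN expRK; ring.
Qed.

Lemma Phi_ge0 q p : 0 <= q -> 0 <= p -> (0 <= Phi q p)%E.
Proof.
move=> q0 p0; have [->|qn0] := eqVneq q 0; first by rewrite /Phi eqxx lee_fin.
have [->|pn0] := eqVneq p 0; first by rewrite /Phi eqxx (negPf qn0).
have {q0}qn0 : 0 < q by rewrite lt_def qn0.
have {p0}pn0 : 0 < p by rewrite lt_def pn0.
have -> : p = q * expR (ln (p / q)).
  by rewrite lnK ?posrE ?divr_gt0 // mulrC divfK // gt_eqF.
by rewrite Phi_expR // lee_fin mulr_ge0 ?(ltW qn0) // subr_ge0 expR_ge1Dx.
Qed.

Lemma Phi_eq0 q p : 0 < q -> 0 < p -> Phi q p = 0%:E -> p = q.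
Proof.
move=> q0 p0.
have -> : p = q * expR (ln (p / q)).
  by rewrite lnK ?posrE ?divr_gt0 // mulrC divfK // gt_eqF.
rewrite Phi_expR // => -[/eqP]; rewrite mulf_eq0 gt_eqF //= subr_eq0.
have [->|t0] := eqVneq (ln (p / q)) 0; first by rewrite expR0 mulr1.
by rewrite gt_eqF // expR_gt1Dx.
Qed.

End Phi.

Theorem corollary5p8 (R : realType) (V : finType) (E : {set V * V})
  (hE : forall x y : V, (x, y) \in E -> x != y)
  (r r' : V -> V -> R)
  (hr : jump_rates r) (hr' : jump_rates r')
  (hrE : forall x y : V, x != y -> (0 < r x y <-> (x, y) \in E))
  (hr'E : forall x y : V, x != y -> (0 < r' x y <-> (x, y) \in E))
  (hrec : forall x : V, recurrent r x)
  (hrec' : forall x : V, recurrent r' x)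
  (hI : forall (mu : fin_prob R V) (J : flow R E),
      rate_functional r mu J = rate_functional r' mu J) :
  forall x y : V, (x, y) \in E -> r x y = r' x y.
Proof.
move=> x y xyE.
pose w (e : edge E) := r (esrc e) (etgt e).
have eE (e : edge E) : (esrc e, etgt e) \in E.
  by case: e => -[a b] abE; exact: abE.
have w_gt0 e : 0 < w e by apply/hrE/eE/hE/eE.
have w'_gt0 (e : edge E) : 0 < r' (esrc e) (etgt e) by apply/hr'E/eE/hE/eE.
have adjE : [rel a b | [exists e : edge E, (esrc e == a) && (etgt e == b)]]
    =2 jump_rel r.
  move=> a b; apply/existsP/andP => [[e /andP[/eqP<- /eqP<-]]|[ab rab]].
    by split; [apply/hE/eE | exact: w_gt0].
  have abE : (a, b) \in E by apply/hrE.
  by exists (exist _ (a, b) abE); rewrite !eqxx.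
have [z|v [v_ge0 vx vK]] := invariant_measure (@esrc V E) (@etgt V E) w w_gt0 x.
  by rewrite !(eq_connect adjE); exact/recurrent_connect/hrec.
pose s := \sum_a v a.
have s_gt0 : 0 < s.
  by rewrite /s (bigD1 x) //= ltr_wpDr // sumr_ge0.
have mu_ge0 a : 0 <= v a / s by rewrite divr_ge0 // ltW.
have mu_sum1 : \sum_a v a / s = 1 by rewrite -mulr_suml divff // gt_eqF.
pose mu := FinProb mu_ge0 mu_sum1.
have J_ge0 e : 0 <= mu (esrc e) * w e by rewrite mulr_ge0 ?mass_ge0 // ltW.
(* The typical flow of [r] under [mu]: each term of its rate functional has the form [Phi q q]. *)
pose J : flow R E := fun e => NngNum (J_ge0 e).
have Jdiv : div_free J.
  apply/forallP => a; apply/eqP => /=.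
  under eq_bigr do rewrite mulrAC; under [RHS]eq_bigr do rewrite mulrAC.
  by rewrite -!mulr_suml vK.
have := hI mu J; rewrite /rate_functional Jdiv big1 => [|e _]; last exact: Phi_diag.
have Phi_r'_ge0 (e : edge E) : true ->
    (0 <= Phi (J e)%:num (mu (esrc e) * r' (esrc e) (etgt e)))%E.
  by move=> _; apply: Phi_ge0 => //; rewrite mulr_ge0 ?mass_ge0 // ltW.
move=> /esym/eqP; rewrite seq_psume_eq0 // => /allP.
move=> /(_ (exist _ (x, y) xyE) (mem_index_enum _))/eqP.
have mux : 0 < mu x by rewrite divr_gt0.
have rxy := w_gt0 (exist _ (x, y) xyE); have r'xy := w'_gt0 (exist _ (x, y) xyE).
(* The flows of [r] and [r'] agree on the edge, and [mu] charges [x], so [mu x] cancels. *)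
move=> /Phi_eq0 eqr; apply: (mulfI (lt0r_neq0 mux)).
by rewrite eqr // mulr_gt0.
Qed.
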